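(* Let $R$ be a ring and let $M\neq 0$ be a right $R$-module. The family $\mathcal{F}$ of all right ideals of $R$ that are not point annihilators of $M$ is a right Oka family. Consequently, every maximal point annihilator of $M$ (that is, every maximal element, with respect to inclusion, of the set of point annihilators of $M$) is a completely prime right ideal of $R$.
   Context: Rings are associative with $1$, modules are unital. A point annihilator of a nonzero right $R$-module $M$ is a right ideal of the form $\operatorname{ann}(m)=\{r\in R: mr=0\}$ for some $0\neq m\in M$. For a right ideal $I$ of $R$ and $a\in R$, put $a^{-1}I:=\{r\in R: ar\in I\}$. A right Oka family in $R$ is a family $\mathcal{F}$ of right ideals of $R$ with $R\in\mathcal{F}$ such that for every right ideal $I$ of $R$ and every $a\in R$: if $I+aR\in\mathcal{F}$ and $a^{-1}I\in\mathcal{F}$, then $I\in\mathcal{F}$. A right ideal $P\subsetneq R$ is completely prime if for all $a,b\in R$ with $aP\subseteq P$, $ab\in P$ implies $a\in P$ or $b\in P$. *)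

(* Defs.v *)
From HB Require Import structures.
From mathcomp Require Import all_boot all_algebra.
From mathcomp Require Import classical_sets.
Set Implicit Arguments.
Unset Strict Implicit.
Unset Printing Implicit Defensive.
Import GRing.Theory.
Local Open Scope classical_set_scope.
Local Open Scope ring_scope.

(* A right R-module is a left module over the converse ring R^c, so that
   m r is written (r : R^c) *: m. The type pzRingType does not assume 1 != 0. *)

Section RightIdeals.
Variable R : pzRingType.
Implicit Types (I P : set R) (F : set (set R)).

Definition right_ideal I :=
  [/\ I 0,
      forall x y, I x -> I y -> I (x + y),
      forall x, I x -> I (- x)
    & forall x r, I x -> I (x * r)].

Definition sum_principal I (a : R) : set R :=
  [set x + a * r | x in I & r in setT].

Definition left_quotient I (a : R) : set R := [set r | I (a * r)].

Definition right_oka_family F :=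
  [/\ forall I, F I -> right_ideal I,
      F setT
    & forall I a, right_ideal I ->
        F (sum_principal I a) -> F (left_quotient I a) -> F I].

Definition completely_prime P :=
  [/\ right_ideal P,
      P <> setT
    & forall a b, (forall p, P p -> P (a * p)) -> P (a * b) -> P a \/ P b].

End RightIdeals.

Section PointAnnihilators.
Variables (R : pzRingType) (M : lmodType R^c).

Definition ann (m : M) : set R := [set r | (r : R^c) *: m = 0].

Definition point_annihilator (I : set R) := exists2 m : M, m <> 0 & I = ann m.

Definition maximal_point_annihilator (P : set R) :=
  point_annihilator P /\
  forall Q, point_annihilator Q -> P `<=` Q -> Q = P.

Definition non_point_annihilators : set (set R) :=
  [set I | right_ideal I /\ ~ point_annihilator I].

End PointAnnihilators.

(* Main.v *)
Require Import Defs.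
From HB Require Import structures.
From mathcomp Require Import all_boot all_algebra.
From mathcomp Require Import boolp classical_sets.
Import GRing.Theory.
Local Open Scope classical_set_scope.
Local Open Scope ring_scope.

(** The Oka property is proved in contrapositive form.  Let [I = ann m] with
    [m <> 0], and let [a] be in [R].  Since [a^-1 (ann m) = ann (m a)]
    ([left_quotient_ann]), the right ideal [a^-1 I] is a point annihilator as
    soon as [m a <> 0].  If instead [m a = 0], then [a] lies in [I], so
    [I + aR = I] ([sum_principal_id]) is a point annihilator.  In both cases
    one of [I + aR] and [a^-1 I] is outside the family.

    The second assertion is the completely prime ideal principle
    ([completely_prime_of_maximal]): a right ideal maximal among those outside
    a right Oka family is completely prime.  Every point annihilator is a right
    ideal, so the right ideals outside [non_point_annihilators M] are exactly
    the point annihilators, and the principle applies to the maximal ones. *)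

Section OkaFamilies.
Variable R : pzRingType.
Implicit Types (I P : set R) (F : set (set R)).

Lemma right_ideal_sum_principal I a :
  right_ideal I -> right_ideal (sum_principal I a).
Proof.
move=> [I0 ID IN IM]; split.
- by exists 0 => //; exists 0 => //; rewrite mulr0 addr0.
- move=> _ _ [x Ix [r _ <-]] [y Iy [s _ <-]].
  by exists (x + y); [exact: ID|exists (r + s) => //; rewrite mulrDr addrACA].
- move=> _ [x Ix [r _ <-]].
  by exists (- x); [exact: IN|exists (- r) => //; rewrite mulrN opprD].
- move=> _ s [x Ix [r _ <-]].
  by exists (x * s); [exact: IM|exists (r * s) => //; rewrite mulrDl mulrA].
Qed.

Lemma right_ideal_left_quotient I a :
  right_ideal I -> right_ideal (left_quotient I a).
Proof.
move=> [I0 ID IN IM]; split; rewrite /left_quotient /=.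
- by rewrite mulr0.
- by move=> x y Ix Iy; rewrite mulrDr; exact: ID.
- by move=> x Ix; rewrite mulrN; exact: IN.
- by move=> x r Ix; rewrite mulrA; exact: IM.
Qed.

Lemma sub_sum_principal I a : I `<=` sum_principal I a.
Proof. by move=> x Ix; exists x => //; exists 0 => //; rewrite mulr0 addr0. Qed.

Lemma mem_sum_principal I a : right_ideal I -> sum_principal I a a.
Proof. by case=> I0 _ _ _; exists 0 => //; exists 1 => //; rewrite mulr1 add0r. Qed.

Lemma sum_principal_id I a : right_ideal I -> I a -> sum_principal I a = I.
Proof.
move=> [_ ID _ IM] Ia; apply/seteqP; split; last exact: sub_sum_principal.
by move=> _ [x Ix [r _ <-]]; apply: ID => //; exact: IM.
Qed.

(** If [a P] is contained in [P] and [a b] is in [P] with neither [a] nor [b]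
    in [P], then [P + aR] (which contains [a]) and [a^-1 P] (which contains [b],
    and contains [P] because [a P] does not leave [P]) are both strictly larger
    than [P].  By maximality both lie in the family, and the Oka condition would
    then put [P] in it. *)
Lemma completely_prime_of_maximal F P :
  right_oka_family F -> right_ideal P -> ~ F P ->
  (forall Q, right_ideal Q -> ~ F Q -> P `<=` Q -> Q = P) ->
  completely_prime P.
Proof.
move=> [_ FT Foka] idP nFP maxP; split=> //; first by move=> PT; rewrite PT in nFP.
move=> a b aPP Pab; apply: contrapT => /not_orP[nPa nPb].
have F_larger Q c : right_ideal Q -> P `<=` Q -> Q c -> ~ P c -> F Q.
  move=> idQ PQ Qc nPc; apply: contrapT => nFQ.
  by apply: nPc; rewrite -(maxP Q).
apply/nFP/(Foka P a) => //.
- apply: (F_larger _ a) => //; first exact: right_ideal_sum_principal.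
  + exact: sub_sum_principal.
  + exact: mem_sum_principal.
- by apply: (F_larger _ b) => //; exact: right_ideal_left_quotient.
Qed.

End OkaFamilies.

Section PointAnnihilators.
Variables (R : pzRingType) (M : lmodType R^c).
Implicit Types m : M.

(** Multiplication in [R^c] is reversed, so this is [m (a r) = (m a) r]. *)
Lemma scale_conv_mul m (a r : R) :
  (a * r : R^c) *: m = (r : R^c) *: ((a : R^c) *: m).
Proof. by rewrite scalerA. Qed.

Lemma left_quotient_ann m (a : R) :
  left_quotient (ann m) a = ann ((a : R^c) *: m).
Proof.
by apply/seteqP; split=> r; rewrite /left_quotient /ann /= scale_conv_mul.
Qed.

Lemma right_ideal_ann m : right_ideal (ann m).
Proof.
split; rewrite /ann /=.
- exact: (scale0r m).
- by move=> x y xm ym; rewrite (scalerDl m (x : R^c) y) xm ym addr0.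
- by move=> x xm; rewrite (scaleNr (x : R^c) m) xm oppr0.
- by move=> x r xm; rewrite scale_conv_mul xm scaler0.
Qed.

Lemma not_point_annihilator_setT : ~ point_annihilator M setT.
Proof.
case=> m m_neq0 Tm; apply: m_neq0.
have : ann m 1 by rewrite -Tm.
by rewrite /ann /= (scale1r m).
Qed.

Lemma right_oka_non_point_annihilators :
  right_oka_family (non_point_annihilators M).
Proof.
split; first by move=> I [].
- by split; [split|exact: not_point_annihilator_setT].
- move=> I a idI [_ nSum] [_ nQuo]; split=> // -[m m_neq0 Im].
  have [ma0|ma_neq0] := pselect ((a : R^c) *: m = 0).
  + have Ia : I a by rewrite Im.
    by apply: nSum; rewrite sum_principal_id //; exists m.
  + by apply: nQuo; rewrite Im left_quotient_ann; exists ((a : R^c) *: m).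
Qed.

End PointAnnihilators.

Theorem proposition5p3 (R : pzRingType) (M : lmodType R^c)
    (M_neq0 : exists m : M, m <> 0) :
  right_oka_family (non_point_annihilators M) /\
  (forall P : set R, maximal_point_annihilator M P -> completely_prime P).
Proof.
have okaF := right_oka_non_point_annihilators R M.
split=> // P [paP maxP]; apply: (completely_prime_of_maximal R _ P okaF).
- by case: paP => m _ ->; exact: right_ideal_ann.
- by case.
- move=> Q idQ nFQ; apply: maxP.
  by apply: contrapT => npaQ; apply: nFQ.
Qed.
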